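(* Consider the problem of minimizing $f(x)$ over $x\in\mathbb{R}^n$ subject to $g^{(i)}(x)\le 0$ ($i=1,\dots,m$), $Ax+b=0$, $x\in X$, under the assumptions (a)–(e) listed in the context, and suppose $p=0$ (no equality constraints). Let $(u_k)_{k=0}^\infty\subset D$ be a sequence generated by the 1-memory fast dual gradient method described in the context. Let $\tilde{x}\in\mathbb{R}^n$ be a point as in assumption (c), let $u^\star\in D^\star$, and let $\bar{u}\in D\setminus D^\star$. Then $$f(\bar{x}(u_k))-f^\star\le\frac{\tilde{L}\,(d(\bar{u})-f(\tilde{x}))\bigl(8(m+p)Q(u^\star,w_0)\bigr)^{1/2}}{(k+1)\bigl(\max_{i\in\{1,\dots,m\}}g^{(i)}(\tilde{x})\bigr)}+\frac{4\tilde{L}Q(u^\star,w_0)}{(k+1)^2},\qquad\forall k>\Bigl(\frac{4\tilde{L}Q(u^\star,w_0)}{d^\star-d(\bar{u})}\Bigr)^{1/2}.$$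
   Context: Problem data: $f:\mathbb{R}^n\to\mathbb{R}$, $g^{(i)}:\mathbb{R}^n\to\mathbb{R}$ for $i\in\{1,\dots,m\}$, $A\in\mathbb{R}^{p\times n}$, $b\in\mathbb{R}^p$, and $X\subseteq\mathbb{R}^n$ closed and convex. Assumptions: (a) $f$ is strongly convex over $X$ with parameter $\theta>0$: $f(y)-f(x)-s^T(y-x)\ge\frac{\theta}{2}\|x-y\|^2$ for all $x,y\in X$ and all $s\in\partial f(x)$ ($f$ need not be differentiable). (b) Each $g^{(i)}$ is convex over $X$ and there is $L_i>0$ with $|g^{(i)}(x)-g^{(i)}(y)|\le L_i\|x-y\|$ for all $x,y\in X$. (c) There exists $\tilde{x}\in\operatorname{relint}X$ with $g^{(i)}(\tilde{x})<0$ for all $i$ and $A\tilde{x}+b=0$. (d) $m+p\ne0$, and if $p\neq0$ then $A$ is not the zero matrix. (e) The set $\bigcup_{u\in D}G(u)$ (defined below) is bounded. (When $p=0$ all terms involving $A$ and $b$ are absent.) Here $\partial$ denotes the subdifferential and $\|\cdot\|$ the Euclidean norm. The problem has a unique optimal solution $x^\star$, with finite optimal value $f^\star=f(x^\star)$. Dual: $v^{(i)}$ is the $i$th entry of a vector $v$ and $v^{(i:j)}$ the subvector of entries $i,\dots,j$. The Lagrangian is $\mathcal{L}(x,u)=f(x)+\sum_{i=1}^m u^{(i)}g^{(i)}(x)+(u^{(m+1:m+p)})^T(Ax+b)$ for $u\in\mathbb{R}^{m+p}$; $D=\{u\in\mathbb{R}^{m+p}:u^{(i)}\ge0,\ i=1,\dots,m\}$;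 for $u\in D$, $\bar{x}(u)$ is the unique minimizer of $\mathcal{L}(\cdot,u)$ over $X$ and $d(u)=\min_{x\in X}\mathcal{L}(x,u)=\mathcal{L}(\bar{x}(u),u)$. The gradient of $d$ at $u\in D$ is $\nabla d(u)=[g^{(1)}(\bar{x}(u)),\dots,g^{(m)}(\bar{x}(u)),(A\bar{x}(u)+b)^T]^T$. The dual problem is to maximize $d$ over $D$; its optimal value is $d^\star$ (and $d^\star=f^\star$), and its set of optimal solutions $D^\star$ is nonempty. For $u\in D$, $G(u)=\bigcup_{i=1}^m\partial g^{(i)}(\bar{x}(u))$ and $\gamma(u)=\frac{\sqrt{m+1}}{\theta}\max\{\sigma_{\max}(A),\sup_{q\in G(u)}\|q\|\}$, where $\sigma_{\max}(A)=\sqrt{\lambda_{\max}(A^TA)}$, $\lambda_{\max}$ being the largest eigenvalue ($\sigma_{\max}(A)=0$ if $A$ has a zero dimension, in particular if $p=0$). Standing assumption (excluding a trivial case): $\gamma(u)>0$ for all $u\in D$. Let $\tilde{L}=\sup_{u\in D}\gamma(u)\bigl(\sigma_{\max}^2(A)+\sum_{i=1}^mL_i^2\bigr)^{1/2}\in(0,\infty)$; it is a Lipschitz constant of $\nabla d$ on $D$. Algorithm (1-memory fast dual gradient method): let $h:\mathbb{R}^{m+p}\to\mathbb{R}$ be strictly convex and differentiable on an open set containing $D$, let $Q(u,v)=h(u)-h(v)-\nabla h(v)^T(u-v)$ for $u\in\mathbb{R}^{m+p}$, $v\in D$, and assume $Q(u,v)\ge\|u-v\|^2/2$ for all $u,v\in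 D$. Let $\ell_{-d}(u,v)=-d(v)-\nabla d(v)^T(u-v)$ for $u,v\in D$. Initialization: let $\beta_0=1$ and choose $u_0,w_0\in D$. At each $k\ge0$: choose a closed convex set $U_k\subseteq\mathbb{R}^{m+p}$ such that $U_k\cap D^\star\ne\emptyset$; set $$v_k=(1-\beta_k)u_k+\beta_kw_k,\quad w_{k+1}=\operatorname{arg\,min}_{u\in U_k\cap D}\ \ell_{-d}(u,v_k)+\beta_k\tilde{L}Q(u,w_k),\quad \hat{u}_{k+1}=(1-\beta_k)u_k+\beta_kw_{k+1};$$ choose $u_{k+1}\in D$ such that $$\ell_{-d}(u_{k+1},v_k)+\tfrac{\tilde{L}}{2}\|u_{k+1}-v_k\|^2\le\ell_{-d}(\hat{u}_{k+1},v_k)+\tfrac{\tilde{L}}{2}\|\hat{u}_{k+1}-v_k\|^2;$$ choose $\beta_{k+1}\le 2/(k+3)$.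
   Formalization: Adds conditions without which the claim is false: f and every g^(i) have a (global) subgradient at each point of X; β_{k+1}>0 and (1−β_{k+1})/β_{k+1}² ≤ 1/β_k² for all k; and u* lies in U_k for every k. *)

(* Defs.v *)
From HB Require Import structures.
From mathcomp Require Export all_boot all_order all_algebra.
From mathcomp Require Export all_classical all_reals all_analysis.
Export Order.TTheory GRing.Theory Num.Theory numFieldNormedType.Exports.
Set Implicit Arguments.
Unset Strict Implicit.
Unset Printing Implicit Defensive.
Local Open Scope classical_set_scope.
Local Open Scope ring_scope.

Definition dotv (R : realType) (n : nat) (x y : 'cV[R]_n) : R :=
  \sum_(i < n) x i 0 * y i 0.

(* The library norm `|x| on matrices is the sup norm, hence this definition. *)
Definition enorm (R : realType) (n : nat) (x : 'cV[R]_n) : R :=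
  Num.sqrt (dotv x x).

Definition subdiff (R : realType) (n : nat) (f : 'cV[R]_n -> R) (x : 'cV[R]_n) :
    set 'cV[R]_n :=
  [set s | forall y, f x + dotv s (y - x) <= f y].

Definition subdifferentiable_on (R : realType) (n : nat) (X : set 'cV[R]_n)
    (f : 'cV[R]_n -> R) : Prop :=
  forall x, X x -> subdiff f x !=set0.

Definition strong_subgradient_ineq (R : realType) (n : nat) (X : set 'cV[R]_n)
    (theta : R) (f : 'cV[R]_n -> R) : Prop :=
  forall x y s, X x -> X y -> subdiff f x s ->
    theta / 2 * enorm (x - y) ^+ 2 <= f y - f x - dotv s (y - x).

Definition strictly_convex_on (R : realType) (n : nat) (S : set 'cV[R]_n)
    (h : 'cV[R]_n -> R) : Prop :=
  forall (x y : 'cV[R]_n) (t : R), S x -> S y -> x != y -> 0 < t < 1 ->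
    h (t *: x + (1 - t) *: y) < t * h x + (1 - t) * h y.

Definition affine_hull (R : realType) (n : nat) (X : set 'cV[R]_n) :
    set 'cV[R]_n :=
  [set x | exists (k : nat) (c : 'I_k -> R) (y : 'I_k -> 'cV[R]_n),
     [/\ forall i, X (y i), \sum_i c i = 1 & x = \sum_i c i *: y i]].

Definition relint (R : realType) (n : nat) (X : set 'cV[R]_n) : set 'cV[R]_n :=
  [set x | affine_hull X x /\ exists2 e : R, 0 < e &
     forall y, affine_hull X y -> enorm (y - x) < e -> X y].

Definition argmin (R : realType) (T : Type) (S : set T) (F : T -> R) : set T :=
  [set x | S x /\ forall y, S y -> F x <= F y].

(* [sup] is 0 on the empty set, so the value is 0 when A has a zero dimension. *)
Definition sigma_max (R : realType) (p n : nat) (A : 'M[R]_(p, n)) : R :=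
  Num.sqrt (sup [set a | eigenvalue (A^T *m A) a]).

Record problem (R : realType) (n m p : nat) := Problem {
  fobj : 'cV[R]_n -> R;
  gcon : 'I_m -> 'cV[R]_n -> R;
  Amx : 'M[R]_(p, n);
  bvec : 'cV[R]_p;
  Xset : set 'cV[R]_n;
  theta : R;
  Lip : 'I_m -> R }.

Section Dual.
Variables (R : realType) (n m p : nat) (P : problem R n m p).
Local Notation f := (fobj P).
Local Notation g := (gcon P).
Local Notation A := (Amx P).
Local Notation b := (bvec P).
Local Notation X := (Xset P).

Definition feasible : set 'cV[R]_n :=
  [set x | [/\ X x, forall i, g i x <= 0 & A *m x + b = 0]].

Definition fstar : R := inf (f @` feasible).

Definition lagrangian (x : 'cV[R]_n) (u : 'cV[R]_(m + p)) : R :=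
  f x + \sum_(i < m) usubmx u i 0 * g i x + dotv (dsubmx u) (A *m x + b).

Definition dual_domain : set 'cV[R]_(m + p) :=
  [set u | forall i : 'I_m, 0 <= usubmx u i 0].

(* The minimizer exists and is unique for u in the dual domain under the
   standing assumptions; elsewhere the value is irrelevant. *)
Definition xbar (u : 'cV[R]_(m + p)) : 'cV[R]_n :=
  xget 0 (argmin X (lagrangian^~ u)).

Definition dual (u : 'cV[R]_(m + p)) : R := lagrangian (xbar u) u.

Definition grad_dual (u : 'cV[R]_(m + p)) : 'cV[R]_(m + p) :=
  col_mx (\col_(i < m) g i (xbar u)) (A *m xbar u + b).

Definition dstar : R := sup (dual @` dual_domain).

Definition dual_solutions : set 'cV[R]_(m + p) :=
  [set u | dual_domain u /\ forall v, dual_domain v -> dual v <= dual u].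

Definition Gset (u : 'cV[R]_(m + p)) : set 'cV[R]_n :=
  \bigcup_(i in [set: 'I_m]) subdiff (g i) (xbar u).

(* The suprema below are finite under [G_bounded] below. *)
Definition gamma (u : 'cV[R]_(m + p)) : R :=
  Num.sqrt m.+1%:R / theta P *
  Num.max (sigma_max A) (sup [set enorm q | q in Gset u]).

Definition Ltilde : R :=
  sup [set gamma u * Num.sqrt (sigma_max A ^+ 2 + \sum_(i < m) Lip P i ^+ 2)
      | u in dual_domain].

Definition slater_point (x : 'cV[R]_n) : Prop :=
  [/\ relint X x, forall i, g i x < 0 & A *m x + b = 0].

Record assumptions : Prop := Assumptions {
  X_closed : closed X;
  X_convex : convex_set X;
  theta_gt0 : 0 < theta P;
  (* Any finite convex function on R^n is subdifferentiable everywhere. This is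
     needed for the next field, which quantifies over subgradients, not to hold
     vacuously. *)
  f_subdiff : subdifferentiable_on X f;
  f_strongly_convex : strong_subgradient_ineq X (theta P) f;
  g_convex : forall i, convex_function X (g i);
  g_subdiff : forall i, subdifferentiable_on X (g i);
  Lip_gt0 : forall i, 0 < Lip P i;
  g_lipschitz : forall i x y, X x -> X y ->
    `|g i x - g i y| <= Lip P i * enorm (x - y);
  slater : exists x, slater_point x;
  constraints_exist : (m + p != 0)%N;
  A_neq0 : (p != 0)%N -> A != 0;
  G_bounded : bounded_set (\bigcup_(u in dual_domain) Gset u);
  gamma_gt0 : forall u, dual_domain u -> 0 < gamma u }.

Definition bregman (h : 'cV[R]_(m + p) -> R) (u v : 'cV[R]_(m + p)) : R :=
  h u - h v - 'd h v (u - v).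

Definition prox_function (h : 'cV[R]_(m + p) -> R) : Prop :=
  (exists O : set 'cV[R]_(m + p),
     [/\ open O, dual_domain `<=` O, strictly_convex_on O h &
         forall v, O v -> differentiable h v]) /\
  (forall u v, dual_domain u -> dual_domain v ->
     enorm (u - v) ^+ 2 / 2 <= bregman h u v).

Definition ell (u v : 'cV[R]_(m + p)) : R :=
  - dual v - dotv (grad_dual v) (u - v).

Record fast_dual_gradient (h : 'cV[R]_(m + p) -> R) (beta : nat -> R)
    (U : nat -> set 'cV[R]_(m + p))
    (u w v uhat : nat -> 'cV[R]_(m + p)) : Prop := FastDualGradient {
  beta_init : beta 0%N = 1;
  w_init : dual_domain (w 0%N);
  u_dual : forall k, dual_domain (u k);
  U_closed : forall k, closed (U k);
  U_convex : forall k, convex_set (U k);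
  U_solutions : forall k, U k `&` dual_solutions !=set0;
  v_step : forall k, v k = (1 - beta k) *: u k + beta k *: w k;
  w_step : forall k, argmin (U k `&` dual_domain)
    (fun z => ell z (v k) + beta k * Ltilde * bregman h z (w k)) (w k.+1);
  uhat_step : forall k, uhat k.+1 = (1 - beta k) *: u k + beta k *: w k.+1;
  u_step : forall k,
    ell (u k.+1) (v k) + Ltilde / 2 * enorm (u k.+1 - v k) ^+ 2
    <= ell (uhat k.+1) (v k) + Ltilde / 2 * enorm (uhat k.+1 - v k) ^+ 2;
  beta_le : forall k, beta k.+1 <= 2 / k.+3%:R }.

End Dual.

(* Main.v *)
Require Import Defs.
From mathcomp Require Import ring lra.
Set Implicit Arguments.
Unset Strict Implicit.
Unset Printing Implicit Defensive.
Local Open Scope classical_set_scope.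
Local Open Scope ring_scope.

(** Why the rate holds. Write x(u) for the minimizer of the Lagrangian at the
multiplier u, and dstar for the value of d at a dual solution ustar.

The Lagrangian at u in D has, at each point of X, a subgradient inequality with
the quadratic term theta/2 |y - x|^2. Hence x(u) exists
([strong_subgradient_argmin], applied in [xbar_argmin]) and the Lagrangian
grows at least like theta/2 |x - x(u)|^2 away from it
([dual_quadratic_growth]). Without equality constraints, the differences of the
constraint values at x(u) and x(v) can be bounded both by the constants L_i and
by the norms of subgradients; multiplying the two bounds produces
  ((grad d(u) - grad d(v)).z)^2 <= theta Ltilde |z|^2 |x(u) - x(v)|^2,
which is [grad_dual_gap]. Completing the square against the quadratic growth
turns it into the descent inequality [dual_descent] for -d with constant
Ltilde, without any integration along a segment. Descent implies the
first-order optimality conditions at ustar: x(ustar) is feasible and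
complementary to ustar. In turn dstar - d(u) dominates
theta/2 |x(ustar) - x(u)|^2 ([dual_gap_growth]).

For the primal gap, f(x(u)) = d(u) - grad d(u).u, while dstar <= fstar and
d(u) <= dstar + grad d(ustar).u. So the gap is at most
(grad d(ustar) - grad d(u)).u, and [grad_dual_gap] with [dual_gap_growth]
bounds it by sqrt (2 Ltilde (dstar - d(u))) |u| ([primal_gap_le]). Two
estimates then remain.

- The dual gap decays like 4 Ltilde Q(ustar, w_0) / (k + 1)^2
  ([dual_gap_rate]): descent at the extrapolated point v_k and the three-point
  property of the Bregman step give a recurrence whose terms telescope after
  division by beta_k^2.
- The Slater point bounds every multiplier u with d(u) >= d(ubar):
  d(ubar) <= f(xt) + (sum of the u_i) max g_i(xt), where the maximum is
  negative. With the decay above, the lower bound on k gives d(u_k) >= d(ubar).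

The resulting bound is the first summand of the claim; the second summand is
nonnegative. *)

(** * Inequalities for the Euclidean inner product *)

Lemma ler_of_eq (R : numDomainType) (x y : R) : x = y -> x <= y.
Proof. by move->. Qed.

Section InnerProduct.
Variables (R : realType) (n : nat).
Implicit Types (x y z : 'cV[R]_n) (a : R).

Lemma dotvC x y : dotv x y = dotv y x.
Proof. by apply: eq_bigr => i _; rewrite mulrC. Qed.

Lemma dotvDr x y z : dotv x (y + z) = dotv x y + dotv x z.
Proof. by rewrite -big_split; apply: eq_bigr => i _; rewrite mxE mulrDr. Qed.

Lemma dotvZr a x y : dotv x (a *: y) = a * dotv x y.
Proof. by rewrite mulr_sumr; apply: eq_bigr => i _; rewrite mxE mulrCA. Qed.

Lemma dotvNr x y : dotv x (- y) = - dotv x y.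
Proof. by rewrite -scaleN1r dotvZr mulN1r. Qed.

Lemma dotvBr x y z : dotv x (y - z) = dotv x y - dotv x z.
Proof. by rewrite dotvDr dotvNr. Qed.

Lemma dotvDl x y z : dotv (x + y) z = dotv x z + dotv y z.
Proof. by rewrite dotvC dotvDr !(dotvC z). Qed.

Lemma dotvZl a x y : dotv (a *: x) y = a * dotv x y.
Proof. by rewrite dotvC dotvZr dotvC. Qed.

Lemma dotvBl x y z : dotv (x - y) z = dotv x z - dotv y z.
Proof. by rewrite dotvC dotvBr !(dotvC z). Qed.

Lemma dotvNl x y : dotv (- x) y = - dotv x y.
Proof. by rewrite dotvC dotvNr dotvC. Qed.

Lemma dotv0l x : dotv 0 x = 0.
Proof. by apply: big1 => i _; rewrite mxE mul0r. Qed.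

Lemma dotv_suml (I : finType) (s : I -> 'cV[R]_n) x :
  dotv (\sum_i s i) x = \sum_i dotv (s i) x.
Proof.
rewrite exchange_big; apply: eq_bigr => j _ /=.
by rewrite summxE mulr_suml.
Qed.

Lemma dotvv_ge0 x : 0 <= dotv x x.
Proof. by apply: sumr_ge0 => i _; rewrite -expr2 sqr_ge0. Qed.

Lemma enorm_ge0 x : 0 <= enorm x.
Proof. exact: sqrtr_ge0. Qed.

Lemma enorm_sqr x : enorm x ^+ 2 = dotv x x.
Proof. by rewrite sqr_sqrtr// dotvv_ge0. Qed.

Lemma enorm_sqrZ a x : enorm (a *: x) ^+ 2 = a ^+ 2 * enorm x ^+ 2.
Proof. by rewrite !enorm_sqr dotvZl dotvZr expr2 mulrA. Qed.

Lemma enorm_subC x y : enorm (x - y) = enorm (y - x).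
Proof. by rewrite /enorm -opprB dotvNr dotvC dotvNr opprK. Qed.

Lemma enorm0 : enorm (0 : 'cV[R]_n) = 0.
Proof. by rewrite /enorm dotv0l sqrtr0. Qed.

Lemma coord_le_enorm x i : `|x i 0| <= enorm x.
Proof.
rewrite -sqrtr_sqr ler_wsqrtr// /dotv (bigD1 i)//= -expr2 lerDl.
by apply: sumr_ge0 => j _; rewrite -expr2 sqr_ge0.
Qed.

Lemma CauchySchwarz_sqr x y : dotv x y ^+ 2 <= dotv x x * dotv y y.
Proof.
have [y0|y0] := eqVneq (dotv y y) 0.
  have /psumr_eq0P yi0 : \sum_i y i 0 * y i 0 = 0 := y0.
  rewrite [dotv x y]big1 ?expr0n ?mulr_ge0 ?dotvv_ge0// => i _.
  have /eqP := yi0 (fun j _ => sqr_ge0 (y j 0)) i isT.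
  by rewrite mulf_eq0 orbb => /eqP ->; rewrite mulr0.
have yy : 0 < dotv y y by rewrite lt_neqAle eq_sym y0 dotvv_ge0.
have := dotvv_ge0 (dotv y y *: x - dotv x y *: y).
rewrite dotvBl !dotvBr !dotvZl !dotvZr (dotvC y x) => h.
rewrite -subr_ge0 -(pmulr_rge0 _ yy); apply: le_trans h _.
by apply: ler_of_eq; ring.
Qed.

Lemma CauchySchwarz x y : `|dotv x y| <= enorm x * enorm y.
Proof.
by rewrite -sqrtr_sqr -sqrtrM ?dotvv_ge0// ler_wsqrtr// CauchySchwarz_sqr.
Qed.

End InnerProduct.

(** * Elementary inequalities and convex combinations *)

Lemma dotv_mulmx (R : realType) (p n : nat) (A : 'M[R]_(p, n)) d z :
  dotv d (A *m z) = dotv (A^T *m d) z.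
Proof.
have dE k (a b : 'cV[R]_k) : dotv a b = (a^T *m b) 0 0.
  by rewrite mxE; apply: eq_bigr => i _; rewrite mxE.
by rewrite !dE trmx_mul trmxK mulmxA.
Qed.

(** All first-order arguments below compare values at a point and at a point
at distance of order t, divide by t, and let t tend to 0; this is the limit
step. *)
Lemma ler_small_perturbation (R : realType) (a b c : R) :
  (forall t : R, 0 < t <= 1 -> a <= b + t * c) -> a <= b.
Proof.
move=> h; apply/ler_addgt0Pl => e e0.
have c1 : 0 < `|c| + 1 by rewrite ltr_pwDr.
pose t := Num.min 1 (e / (`|c| + 1)).
have t01 : 0 < t <= 1 by rewrite /t lt_min ltr01 divr_gt0//= ge_min lexx.
apply: (le_trans (h t t01)); rewrite addrC lerD2r.
have [t0 _] := andP t01.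
apply: (@le_trans _ _ (t * (`|c| + 1))).
  by rewrite ler_wpM2l ?(ltW t0)// (le_trans (ler_norm c))// lerDl.
by rewrite -ler_pdivlMr// /t ge_min lexx orbT.
Qed.

Lemma convex_setP (R : realType) (n : nat) (X : set 'cV[R]_n) x y (t : R) :
  convex_set X -> X x -> X y -> 0 <= t <= 1 -> X (t *: x + (1 - t) *: y).
Proof.
move=> cX Xx Xy t01.
have := cX x y (Itv01 (andP t01).1 (andP t01).2).
rewrite !inE => /(_ Xx Xy); exact.
Qed.

(** The inequality of arithmetic and geometric means, in the form in which a
product bound on a cross term is absorbed by two quadratic terms. *)
Lemma young_lower (R : realType) (t a b : R) :
  0 <= a -> 0 <= b -> t ^+ 2 <= a * b -> 0 <= 2 * t + a + b.
Proof.
move=> a0 b0 tab; rewrite leNgt; apply/negP => neg.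
have : 0 < (- (2 * t) - (a + b)) * (- (2 * t) + (a + b)).
  by rewrite mulr_gt0//; lra.
have := sqr_ge0 (a - b); nra.
Qed.

(** * Minimizers of strongly convex functions *)

Definition strong_subgradient (R : realType) (n : nat) (X : set 'cV[R]_n)
    (th : R) (F : 'cV[R]_n -> R) (x s : 'cV[R]_n) :=
  forall y, X y -> F x + dotv s (y - x) + th / 2 * enorm (y - x) ^+ 2 <= F y.

Section StronglyConvex.
Variables (R : realType) (n : nat) (X : set 'cV[R]_n) (th : R).
Variable F : 'cV[R]_n -> R.
Hypothesis X_closed : closed X.
Hypothesis X_convex : convex_set X.
Hypothesis th0 : 0 < th.
Hypothesis F_subgrad : forall x, X x -> exists s, strong_subgradient X th F x s.

(** Average the two subgradient inequalities at the convex combination: the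
linear terms cancel and the quadratic ones add up to t (1 - t). *)
Lemma strong_subgradient_convex x y (t : R) : X x -> X y -> 0 <= t <= 1 ->
  F (t *: x + (1 - t) *: y) + th / 2 * (t * (1 - t)) * enorm (x - y) ^+ 2
  <= t * F x + (1 - t) * F y.
Proof.
move=> Xx Xy t01; set z := t *: x + _.
have Xz : X z by exact: convex_setP.
have [s sz] := F_subgrad Xz.
have xzE : x - z = (1 - t) *: (x - y).
  by apply/matrixP => i j; rewrite /z !mxE; ring.
have yzE : y - z = - t *: (x - y).
  by apply/matrixP => i j; rewrite /z !mxE; ring.
move: (sz x Xx) (sz y Xy); rewrite xzE yzE !enorm_sqrZ !dotvZr.
move: (dotv s _) (enorm _ ^+ 2) (F x) (F y) (F z) => a D fx fy fz h1 h2.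
have [t0 t1] := andP t01.
have t1' : 0 <= 1 - t by rewrite subr_ge0.
have := lerD (ler_wpM2l t0 h1) (ler_wpM2l t1' h2).
by apply: le_trans; apply: ler_of_eq; field.
Qed.

Lemma argmin_quadratic_growth x y : argmin X F x -> X y ->
  F x + th / 2 * enorm (y - x) ^+ 2 <= F y.
Proof.
move=> [Xx xmin] Xy.
apply: (@ler_small_perturbation _ _ _ (th / 2 * enorm (y - x) ^+ 2)) => t.
move=> /andP[t0 t1]; have t01 : 0 <= t <= 1 by rewrite ltW.
have h1 := strong_subgradient_convex Xy Xx t01.
have := xmin _ (convex_setP X_convex Xy Xx t01).
move: h1; move: (F (_ + _)) (enorm _ ^+ 2) (F x) (F y) => fz D fx fy h1 h2.
rewrite -(ler_pM2l t0); lra.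
Qed.

(** The lower bound is the unconstrained minimum of the quadratic minorant at
any point of X, obtained by completing the square. *)
Lemma strong_subgradient_has_inf : X !=set0 -> has_inf (F @` X).
Proof.
move=> [x0 Xx0]; split; first by exists (F x0), x0.
have [s ss] := F_subgrad Xx0.
exists (F x0 - dotv s s / (2 * th)) => _ [y Xy <-].
apply: le_trans (ss y Xy); rewrite -addrA lerD2l; move: (y - x0) => d.
have := dotvv_ge0 (s + th *: d).
rewrite enorm_sqr dotvDl !dotvDr !dotvZl !dotvZr (dotvC d s).
move: (dotv s s) (dotv s d) (dotv d d) => a b c h.
rewrite -subr_ge0 -(pmulr_rge0 _ (_ : 0 < 2 * th)) ?mulr_gt0//.
apply: le_trans h _.
by apply: ler_of_eq; field; rewrite gt_eqF.
Qed.

(** By strong convexity at midpoints a minimizing sequence is Cauchy. The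
subgradient inequality at its limit then plays the role of lower
semicontinuity. *)
Lemma strong_subgradient_argmin : X !=set0 -> argmin X F !=set0.
Proof.
move=> X0; have hi := strong_subgradient_has_inf X0.
set I := inf (F @` X) in hi *.
have I_le y : X y -> I <= F y by move=> Xy; apply: ge_inf; [case: hi|exists y].
have /choice[x xP] k : exists x, X x /\ F x < I + k.+1%:R^-1.
  have k0 : (0 : R) < k.+1%:R^-1 by rewrite invr_gt0.
  by have [_ [x Xx <-] h] := inf_adherent k0 hi; exists x.
have x_close j k : (j <= k)%N ->
    th / 8 * enorm (x j - x k) ^+ 2 <= j.+1%:R^-1.
  move=> jk; have [[Xj hj] [Xk hk]] := (xP j, xP k).
  have half01 : 0 <= (2^-1 : R) <= 1 by lra.
  have := strong_subgradient_convex Xj Xk half01.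
  have := I_le _ (convex_setP X_convex Xj Xk half01).
  have kj : (k.+1%:R^-1 : R) <= j.+1%:R^-1.
    by rewrite lef_pV2 ?posrE ?ltr0n// ler_nat.
  move: kj hj hk.
  move: (_ %:R^-1) (_ %:R^-1) (F _) (F (x _)) (F (x _)) (_ ^+ 2).
  by move=> ij ik fz fj fk D *; lra.
have /cauchy_cvgP : cauchy (x @ \oo).
  apply: cauchy_exP => e e0.
  have : \forall N \near \oo, N.+1%:R^-1 < th / 8 * e ^+ 2.
    apply: near_infty_natSinv_lt (PosNum _).
    by rewrite ?mulr_gt0 ?divr_gt0// exprn_gt0.
  case=> N _ /(_ N (leqnn N)) /= hN.
  exists (x N); exists N => // k /= Nk.
  split=> // i j; rewrite (ord1 j) /ball /=.
  have : enorm (x N - x k) < e.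
    rewrite -(ltr_pXn2r (_ : 0 < 2)%N) ?nnegrE ?enorm_ge0 ?(ltW e0)//.
    rewrite -(ltr_pM2l (_ : 0 < th / 8)) ?divr_gt0//.
    exact: le_lt_trans (x_close _ _ Nk) hN.
  by apply: le_lt_trans; have := coord_le_enorm (x N - x k) i; rewrite !mxE.
move=> /cvg_ex[l xl].
have Xl : X l.
  have Xx : \forall k \near \oo, X (x k) by apply: nearW => k; case: (xP k).
  exact: closed_cvg X_closed Xx _ xl.
exists l; split=> // y Xy; apply: le_trans (I_le _ Xy).
have [s sl] := F_subgrad Xl.
(* The linear term at x k is at least - e times the l1-norm of s as soon as x k
   is within e of the limit in the sup norm. *)
apply: (@ler_small_perturbation _ _ _ (1 + \sum_i `|s i 0|)) => e /andP[e0 _].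
have : \forall k \near \oo, ball l e (x k) /\ k.+1%:R^-1 < e.
  near=> k; split; last by near: k; exact: (near_infty_natSinv_lt (PosNum e0)).
  by near: k; move/cvg_ballP : xl; exact.
case=> k _ /(_ k (leqnn k)) [[_ lk] ke].
have [Xk hk] := xP k; have := sl _ Xk.
have {}hk : F (x k) < I + e by rewrite (lt_trans hk)// ltrD2l.
have h2 : - (e * \sum_i `|s i 0|) <= dotv s (x k - l).
  rewrite mulr_sumr -sumrN; apply: ler_sum => i _.
  rewrite lerNl; apply: le_trans (ler_norm _) _.
  rewrite normrN normrM mulrC ler_wpM2r// !mxE distrC ltW//.
  exact: lk.
have h3 : 0 <= th / 2 * enorm (x k - l) ^+ 2.
  by rewrite mulr_ge0 ?sqr_ge0// divr_ge0// ltW.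
rewrite mulrDr mulr1.
by move: h2 h3; move: (dotv s _) (_ * _ ^+ 2) (e * _) => a b c *; lra.
Unshelve. all: by end_near. Qed.

End StronglyConvex.


(** * Lagrangian and dual function *)

Section Lagrangian.
Variables (R : realType) (n m p : nat) (P : problem R n m p).
Hypothesis hP : assumptions P.
Local Notation D := (@dual_domain R m p).
Local Notation X := (Xset P).
Implicit Types (x y : 'cV[R]_n) (u v z : 'cV[R]_(m + p)).

(** The constraint values at x, stacked as a multiplier-sized vector: the
Lagrangian is affine in u with this gradient, and the gradient of the dual is
its value at the minimizer. *)
Definition slack x : 'cV[R]_(m + p) :=
  col_mx (\col_(i < m) gcon P i x) (Amx P *m x + bvec P).

Lemma dotv_col_mx (a : 'cV[R]_m) (b : 'cV[R]_p) z :
  dotv (col_mx a b) z = dotv a (usubmx z) + dotv b (dsubmx z).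
Proof.
rewrite /dotv big_split_ord /=; congr (_ + _); apply: eq_bigr => i _.
  by rewrite col_mxEu mxE.
by rewrite col_mxEd mxE.
Qed.

Lemma lagrangianE x u : lagrangian P x u = fobj P x + dotv (slack x) u.
Proof.
rewrite /lagrangian dotv_col_mx addrA (dotvC (Amx P *m x + bvec P)).
by do 2 congr (_ + _); apply: eq_bigr => i _; rewrite mxE mulrC.
Qed.

Lemma dual_domainD u z : D u -> D z -> D (u + z).
Proof.
by move=> Du Dz i; have := (Du i, Dz i); rewrite !mxE => -[]; exact: addr_ge0.
Qed.

Lemma dual_domainZ (a : R) u : 0 <= a -> D u -> D (a *: u).
Proof. by move=> a0 Du i; have := Du i; rewrite !mxE; exact: mulr_ge0. Qed.

Lemma dual_domain_convex u z (t : R) : D u -> D z -> 0 <= t <= 1 ->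
  D ((1 - t) *: u + t *: z).
Proof.
move=> Du Dz /andP[t0 t1].
by apply: dual_domainD; apply: dual_domainZ; rewrite ?subr_ge0.
Qed.

Lemma slater_point_feasible x : slater_point P x -> feasible P x.
Proof.
case=> -[affx [e e0 xe]] gx Ax; split=> //; last by move=> i; exact: ltW.
by apply: xe => //; rewrite subrr enorm0.
Qed.

(** Nonnegative multipliers preserve subgradient inequalities, and the
quadratic term comes from f. *)
Lemma lagrangian_strong_subgradient u x : D u -> X x ->
  exists s, strong_subgradient X (theta P) (lagrangian P ^~ u) x s.
Proof.
move=> Du Xx.
have [s sx] := f_subdiff hP Xx.
have /choice[q qx] : forall i, exists q, subdiff (gcon P i) x q.
  by move=> i; exact: (g_subdiff hP i Xx).
exists (s + \sum_i usubmx u i 0 *: q i + (Amx P)^T *m dsubmx u) => y Xy.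
rewrite /lagrangian !dotvDl dotv_suml -dotv_mulmx.
have hf := f_strongly_convex hP Xx Xy sx.
have hg : \sum_i usubmx u i 0 * gcon P i x
          + \sum_i dotv (usubmx u i 0 *: q i) (y - x)
          <= \sum_i usubmx u i 0 * gcon P i y.
  rewrite -big_split; apply: ler_sum => i _ /=.
  by rewrite dotvZl -mulrDr ler_wpM2l// qx.
have hA : dotv (dsubmx u) (Amx P *m y + bvec P)
    = dotv (dsubmx u) (Amx P *m x + bvec P)
      + dotv (dsubmx u) (Amx P *m (y - x)).
  rewrite mulmxBr -dotvDr; congr dotv.
  by apply/matrixP => i j; rewrite !mxE; ring.
rewrite hA; move: hf; rewrite (enorm_subC x y); move: hg; clear.
move: (\sum_i _) (\sum_i _) (\sum_i _) (dotv _ _) (dotv _ _) (dotv _ _).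
move: (_ * _ ^+ 2) (fobj P x) (fobj P y) => e f1 f2 a b c d1 d2 d3.
by move=> *; lra.
Qed.

Lemma xbar_argmin u : D u -> argmin X (lagrangian P ^~ u) (xbar P u).
Proof.
move=> Du; have [x0 /slater_point_feasible[Xx0 _ _]] := slater hP.
have [x xmin] : argmin X (lagrangian P ^~ u) !=set0.
  apply: (strong_subgradient_argmin (X_closed hP) (X_convex hP) (theta_gt0 hP)).
    by move=> x; exact: lagrangian_strong_subgradient.
  by exists x0.
exact: xgetI xmin.
Qed.

Lemma xbar_X u : D u -> X (xbar P u).
Proof. by case/xbar_argmin. Qed.

Lemma dual_quadratic_growth u x : D u -> X x ->
  dual P u + theta P / 2 * enorm (x - xbar P u) ^+ 2 <= lagrangian P x u.
Proof.
move=> Du; apply: (argmin_quadratic_growth (X_convex hP) _ (xbar_argmin Du)).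
by move=> y; exact: lagrangian_strong_subgradient.
Qed.

Lemma dual_le_lagrangian u x : D u -> X x -> dual P u <= lagrangian P x u.
Proof. by move=> /xbar_argmin[_]; exact. Qed.

Lemma lagrangian_shift x u v :
  lagrangian P x v = lagrangian P x u + dotv (slack x) (v - u).
Proof. by rewrite !lagrangianE dotvBr addrACA subrr addr0 ?addrA; ring. Qed.

(** The dual is a minimum of functions affine in u, so the one attained at v
majorizes it. *)
Lemma dual_le_linearization u v : D u -> D v ->
  dual P u <= dual P v + dotv (grad_dual P v) (u - v).
Proof.
move=> Du Dv; apply: le_trans (dual_le_lagrangian Du (xbar_X Dv)) _.
by rewrite (lagrangian_shift _ v).
Qed.

Lemma weak_duality u x : D u -> feasible P x -> dual P u <= fobj P x.
Proof.
move=> Du [Xx gx Ax]; apply: le_trans (dual_le_lagrangian Du Xx) _.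
rewrite /lagrangian Ax dotvC dotv0l addr0 gerDl.
by apply: sumr_le0 => i _; exact: mulr_ge0_le0.
Qed.

Lemma dual_le_fstar u : D u -> dual P u <= fstar P.
Proof.
move=> Du; apply: lb_le_inf.
  by have [x /slater_point_feasible Fx] := slater hP; exists (fobj P x), x.
by move=> _ [x Fx <-]; exact: weak_duality.
Qed.

Lemma dstarE u : dual_solutions P u -> dstar P = dual P u.
Proof.
move=> [Du umax]; apply/eqP; rewrite eq_le; apply/andP; split.
  by apply: ge_sup; [exists (dual P u), u|move=> _ [v Dv <-]; exact: umax].
by apply: ub_le_sup; [exists (dual P u) => _ [v Dv <-]; exact: umax|exists u].
Qed.

(** Boundedness is stated for the sup norm; this transfers it to the Euclidean
norm, which makes the suprema in gamma and Ltilde finite. *)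
Lemma Gset_bounded : exists M, forall u q, D u -> Gset P u q -> enorm q <= M.
Proof.
have [M [_ /(_ (M + 1)) hM]] := G_bounded hP.
exists (Num.sqrt (n%:R * (M + 1) ^+ 2)) => u q Du Gq.
rewrite ler_wsqrtr// /dotv.
apply: (@le_trans _ _ (\sum_(i < n) (M + 1) ^+ 2)); last first.
  by rewrite sumr_const card_ord mulr_natl.
apply: ler_sum => i _; rewrite -expr2 -real_normK ?num_real//.
have qi : `|q i 0| <= M + 1.
  have : `|q| <= M + 1 by apply: hM; [rewrite ltrDl|exists u].
  apply: le_trans; rewrite [leRHS](mx_normrE q).
  exact: (@le_bigmax _ _ _ _ (fun ij => `|q ij.1 ij.2|) (i, 0)).
by rewrite ler_pXn2r// nnegrE// (le_trans _ qi).
Qed.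

(** Ltilde and the subgradient term of gamma are suprema of sets that are
bounded above by [Gset_bounded], so they dominate the values at u and q. *)
Lemma Ltilde_ge u q : D u -> Gset P u q ->
  Num.sqrt m.+1%:R * enorm q * Num.sqrt (\sum_i Lip P i ^+ 2)
  <= theta P * Ltilde P.
Proof.
move=> Du Gq; have [M hM] := Gset_bounded.
have th0 := theta_gt0 hP.
have q_le_sup : enorm q <= sup [set enorm q | q in Gset P u].
  by apply: ub_le_sup; [exists M => _ [r Gr <-]; exact: (hM u)|exists q].
set C := Num.sqrt m.+1%:R / theta P.
have C0 : 0 <= C by rewrite divr_ge0 ?sqrtr_ge0 ?ltW.
set S := Num.sqrt (sigma_max (Amx P) ^+ 2 + \sum_i Lip P i ^+ 2).
have S_ge : Num.sqrt (\sum_i Lip P i ^+ 2) <= S.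
  by rewrite ler_wsqrtr// lerDr sqr_ge0.
have gammaS_le : gamma P u * S <= Ltilde P.
  apply: ub_le_sup; last by exists u.
  exists (C * Num.max (sigma_max (Amx P)) (Num.max 0 M) * S) => _ [v Dv <-].
  rewrite ler_wpM2r ?sqrtr_ge0// ler_wpM2l// ge_max !le_max lexx /=.
  apply/orP; right; have [->|/set0P[r Gr]] := eqVneq (Gset P v) set0.
    by rewrite image_set0 sup0 lexx.
  apply/orP; right; apply: ge_sup; first by exists (enorm r), r.
  by move=> _ [r' Gr' <-]; exact: (hM v).
rewrite [leRHS]mulrC -ler_pdivrMr//; apply: le_trans gammaS_le.
rewrite [leLHS](_ : _ = C * enorm q * Num.sqrt (\sum_i Lip P i ^+ 2));
  last by rewrite /C; ring.
apply: ler_pM S_ge; rewrite ?sqrtr_ge0//; first exact: mulr_ge0 (enorm_ge0 q).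
by rewrite ler_wpM2l// le_max q_le_sup orbT.
Qed.

(** A subgradient at the point with the larger value of the constraint controls
the difference, whence the choice between u and v. *)
Lemma gcon_gap_le_subgradient i u v : D u -> D v ->
  exists2 q, Gset P u q \/ Gset P v q &
    `|gcon P i (xbar P u) - gcon P i (xbar P v)|
    <= enorm q * enorm (xbar P u - xbar P v).
Proof.
wlog vu : u v / gcon P i (xbar P v) <= gcon P i (xbar P u) => [hw Du Dv|].
  have [/hw|/ltW /hw] := leP (gcon P i (xbar P v)) (gcon P i (xbar P u)).
    exact.
  by move=> /(_ Dv Du)[q Gq h]; exists q; [tauto|rewrite distrC enorm_subC].
move=> Du Dv; have [q qx] := g_subdiff hP i (xbar_X Du).
exists q; first by left; exists i.
rewrite ger0_norm ?subr_ge0// enorm_subC.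
apply: le_trans (CauchySchwarz _ _); rewrite -normrN.
apply: le_trans (ler_norm _); have := qx (xbar P v); lra.
Qed.

Lemma usubmx_enorm_le z : enorm (usubmx z) <= enorm z.
Proof.
rewrite ler_wsqrtr// -{3 4}(vsubmxK z) dotv_col_mx col_mxKu col_mxKd.
by rewrite lerDl dotvv_ge0.
Qed.

(** * Smoothness of the dual and the primal gap *)

Section InequalityConstraintsOnly.
Hypothesis hp : p = 0%N.

Lemma dotv_dim0 (a b : 'cV[R]_p) : dotv a b = 0.
Proof. by rewrite /dotv big1// => i; move: (ltn_ord i); rewrite {2}hp. Qed.

Lemma m_gt0 : (0 < m)%N.
Proof. by have := constraints_exist hP; rewrite hp addn0 lt0n. Qed.

Lemma Ltilde_ge0 : 0 <= Ltilde P.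
Proof.
have D0 : D 0 by move=> i; rewrite !mxE.
have [q qx] := g_subdiff hP (Ordinal m_gt0) (xbar_X D0).
have := Ltilde_ge D0 (ex_intro2 _ _ (Ordinal m_gt0) I qx).
rewrite -(pmulr_rge0 _ (theta_gt0 hP)); apply: le_trans.
by rewrite !mulr_ge0 ?sqrtr_ge0.
Qed.

(** Let T be the sum of |z_i| |g_i(x(u)) - g_i(x(v))|, b the distance of x(u)
and x(v), L the Euclidean norm of the Lipschitz constants. The Lipschitz bounds
give T <= L |z| b, the subgradient bounds give L T <= theta Ltilde |z| b; the
product of the two eliminates L. *)
Lemma grad_dual_gap u v z : D u -> D v ->
  dotv (grad_dual P u - grad_dual P v) z ^+ 2
  <= theta P * Ltilde P * enorm z ^+ 2 * enorm (xbar P u - xbar P v) ^+ 2.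
Proof.
move=> Du Dv; set b := enorm (xbar P u - xbar P v).
set a := enorm z; have [a0 b0] : 0 <= a /\ 0 <= b by rewrite !enorm_ge0.
pose delta i := `|gcon P i (xbar P u) - gcon P i (xbar P v)|.
pose zeta : 'cV[R]_m := \col_i `|usubmx z i 0|.
pose T := \sum_i delta i * zeta i 0.
have zeta0 i : 0 <= zeta i 0 by rewrite mxE.
have T0 : 0 <= T by apply: sumr_ge0 => i _; rewrite mulr_ge0 /delta.
have normT : `|dotv (grad_dual P u - grad_dual P v) z| <= T.
  rewrite dotvBl !dotv_col_mx !dotv_dim0 !addr0 -dotvBl.
  apply: le_trans (ler_norm_sum _ _ _) _; apply: ler_sum => i _.
  by rewrite normrM !mxE.
have zeta_a : enorm zeta <= a.
  apply: le_trans (usubmx_enorm_le z); rewrite ler_wsqrtr//.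
  by apply: ler_sum => i _; rewrite !mxE -normrM ger0_norm// -expr2 sqr_ge0.
set L := Num.sqrt (\sum_i Lip P i ^+ 2).
have T_lip : T <= L * a * b.
  have -> : L = enorm (\col_i Lip P i).
    by congr Num.sqrt; apply: eq_bigr => i _; rewrite !mxE expr2.
  have /(le_trans (ler_norm _)) := CauchySchwarz (\col_i Lip P i) zeta.
  move=> h; apply: (@le_trans _ _ (dotv (\col_i Lip P i) zeta * b)).
    rewrite mulr_suml; apply: ler_sum => i _; rewrite !mxE mulrAC.
    by rewrite ler_wpM2r//; apply: (g_lipschitz hP); exact: xbar_X.
  by rewrite ler_wpM2r// (le_trans h)// ler_wpM2l ?enorm_ge0.
have T_sub : L * T <= theta P * Ltilde P * a * b.
  have s0 : 0 < Num.sqrt m.+1%:R :> R by rewrite sqrtr_gt0.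
  have tL0 : 0 <= theta P * Ltilde P.
    by rewrite mulr_ge0 ?Ltilde_ge0// ltW// theta_gt0.
  rewrite -(ler_pM2l s0).
  (* The l1-norm of z is at most sqrt m times its Euclidean norm; the factor
     sqrt (m + 1) in gamma pays for it. *)
  have one_norm : enorm (const_mx 1 : 'cV[R]_m) <= Num.sqrt m.+1%:R.
    rewrite ler_wsqrtr// /dotv (eq_bigr (fun=> 1)) => [|i _].
      by rewrite sumr_const card_ord ler_nat.
    by rewrite mxE mulr1.
  have /(le_trans (ler_norm _)) := CauchySchwarz (const_mx 1) zeta.
  move=> h.
  apply: (@le_trans _ _ (theta P * Ltilde P * b * dotv (const_mx 1) zeta)).
    rewrite !mulr_sumr; apply: ler_sum => i _.
    rewrite [const_mx _ _ _]mxE mul1r !mulrA.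
    rewrite ler_wpM2r//.
    have [q Gq hq] := gcon_gap_le_subgradient i Du Dv.
    apply: (@le_trans _ _ (Num.sqrt m.+1%:R * enorm q * L * b)).
      rewrite [leRHS](_ : _ = Num.sqrt m.+1%:R * L * (enorm q * b));
        last by ring.
      by rewrite ler_wpM2l// mulr_ge0// sqrtr_ge0.
    by rewrite ler_wpM2r//; case: Gq => /Ltilde_ge; apply.
  apply: (@le_trans _ _ (theta P * Ltilde P * b * (Num.sqrt m.+1%:R * a))).
    rewrite ler_wpM2l ?(mulr_ge0 tL0)//; apply: le_trans h _.
    by rewrite ler_pM ?enorm_ge0.
  by apply: ler_of_eq; ring.
rewrite -real_normK ?num_real//.
apply: (@le_trans _ _ (T ^+ 2)); first by rewrite ler_pXn2r// nnegrE.
have ab0 : 0 <= a * b by rewrite mulr_ge0.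
have h1 := ler_wpM2l T0 T_lip; have h2 := ler_wpM2r ab0 T_sub.
rewrite expr2; apply: (le_trans h1).
rewrite [leLHS](_ : _ = L * T * (a * b)); last by ring.
by apply: (le_trans h2); apply: ler_of_eq; ring.
Qed.

(** In d(u) = lagrangian (x(u), v) + grad d(u).(u - v), replacing grad d(u) by
grad d(v) costs a cross term that [grad_dual_gap] bounds by the geometric mean
of the growth theta |x(u) - x(v)|^2 and of Ltilde |u - v|^2. *)
Lemma dual_descent u v : D u -> D v ->
  - dual P u <= ell P u v + Ltilde P / 2 * enorm (u - v) ^+ 2.
Proof.
move=> Du Dv; rewrite /ell.
have h1 : dual P u = lagrangian P (xbar P u) v + dotv (grad_dual P u) (u - v).
  exact: lagrangian_shift.
have h2 := dual_quadratic_growth Dv (xbar_X Du).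
have := grad_dual_gap (u - v) Du Dv; rewrite dotvBl.
rewrite [leRHS](_ : _ = (theta P * enorm (xbar P u - xbar P v) ^+ 2)
  * (Ltilde P * enorm (u - v) ^+ 2)); last by ring.
move/(young_lower (mulr_ge0 (ltW (theta_gt0 hP)) (sqr_ge0 _))).
move/(_ (mulr_ge0 Ltilde_ge0 (sqr_ge0 _))); move: h1 h2.
move: (enorm _ ^+ 2) (enorm _ ^+ 2) (dotv _ _) (dotv _ _) => B A d1 d2.
by move: (dual P u) (lagrangian _ _ _) (dual P v) => du l dv; lra.
Qed.

(** Descent replaces differentiability of d: along the segment from the
solution to z, d increases at the rate given by its gradient up to a quadratic
error, and it cannot exceed its maximum. *)
Lemma dual_solution_optimality us z : dual_solutions P us -> D z ->
  dotv (grad_dual P us) (z - us) <= 0.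
Proof.
move=> [Dus umax] Dz.
apply: (@ler_small_perturbation _ _ _ (Ltilde P / 2 * enorm (z - us) ^+ 2)).
move=> t /andP[t0 t1]; have t01 : 0 <= t <= 1 by rewrite ltW.
have Dt := dual_domain_convex Dus Dz t01.
have := dual_descent Dt Dus; have := umax _ Dt; rewrite /ell.
have -> : (1 - t) *: us + t *: z - us = t *: (z - us).
  by apply/matrixP => i j; rewrite !mxE; ring.
rewrite dotvZr enorm_sqrZ => h1 h2; rewrite add0r -(ler_pM2l t0).
move: h1 h2; move: (dual P _) (dual P us) (dotv _ _) (enorm _ ^+ 2) => a b c d.
by move=> *; nra.
Qed.

(** Equivalent to the feasibility of x(ustar), as u ranges over the orthant. *)
Lemma dual_solution_slack_le0 us u : dual_solutions P us -> D u ->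
  dotv (grad_dual P us) u <= 0.
Proof.
move=> us_sol Du; have Dus : D us by case: us_sol.
have := dual_solution_optimality us_sol (dual_domainD Dus Du).
by rewrite addrC addKr.
Qed.

Lemma dual_solution_complementarity us : dual_solutions P us ->
  dotv (grad_dual P us) us = 0.
Proof.
move=> us_sol; have Dus : D us by case: us_sol.
apply/eqP; rewrite eq_le dual_solution_slack_le0//=.
have D0 : D 0 by move=> i; rewrite !mxE.
by have := dual_solution_optimality us_sol D0; rewrite sub0r dotvNr oppr_le0.
Qed.

Lemma lagrangian_at_solution us u : dual_solutions P us ->
  lagrangian P (xbar P us) u = dual P us + dotv (grad_dual P us) u.
Proof.
move=> us_sol; rewrite (lagrangian_shift _ us) dotvBr.
by rewrite [dotv _ us]dual_solution_complementarity// subr0.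
Qed.

(** Evaluate the growth of the Lagrangian at u, around x(u), at the point
x(ustar): there its value is at most dstar, by feasibility and
complementarity. *)
Lemma dual_gap_growth us u : dual_solutions P us -> D u ->
  theta P / 2 * enorm (xbar P us - xbar P u) ^+ 2 <= dual P us - dual P u.
Proof.
move=> us_sol Du; have Dus : D us by case: us_sol.
have := dual_quadratic_growth Du (xbar_X Dus).
rewrite lagrangian_at_solution//.
have := dual_solution_slack_le0 us_sol Du; lra.
Qed.

(** The gap is at most (grad d(ustar) - grad d(u)).u; [grad_dual_gap] turns
this into the distance from x(ustar) to x(u), and [dual_gap_growth] turns the
distance into the dual gap. *)
Lemma primal_gap_le us u : dual_solutions P us -> D u ->
  fobj P (xbar P u) - fstar P
  <= Num.sqrt (2 * Ltilde P * (dual P us - dual P u)) * enorm u.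
Proof.
move=> us_sol Du; have Dus : D us by case: us_sol.
have h1 := dual_le_lagrangian Du (xbar_X Dus).
rewrite lagrangian_at_solution// in h1.
have h2 : dual P u = fobj P (xbar P u) + dotv (grad_dual P u) u.
  exact: lagrangianE.
have h3 := dual_le_fstar Dus.
apply: (@le_trans _ _ (dotv (grad_dual P us - grad_dual P u) u)).
  rewrite dotvBl; lra.
apply: le_trans (ler_norm _) _.
have gap0 : 0 <= dual P us - dual P u.
  by rewrite subr_ge0; case: us_sol => _; apply.
have L0 := Ltilde_ge0.
rewrite -sqrtr_sqr -[enorm u]ger0_norm ?enorm_ge0// -(sqrtr_sqr (enorm u)).
rewrite -sqrtrM ?mulr_ge0// ler_wsqrtr//.
apply: le_trans (grad_dual_gap u Dus Du) _.
have := ler_wpM2l (mulr_ge0 L0 (sqr_ge0 (enorm u))) (dual_gap_growth us_sol Du).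
move: (enorm _ ^+ 2) (enorm _ ^+ 2) => A B; nra.
Qed.

Lemma enorm_le_sum_multipliers u : D u -> enorm u <= \sum_i usubmx u i 0.
Proof.
move=> Du; have S0 : 0 <= \sum_i usubmx u i 0 by apply: sumr_ge0.
rewrite -[leRHS]ger0_norm// -sqrtr_sqr ler_wsqrtr//.
rewrite -{1 2}(vsubmxK u) dotv_col_mx dotv_dim0 addr0 col_mxKu.
rewrite expr2 {1}mulr_suml; apply: ler_sum => i _.
rewrite ler_wpM2l// (bigD1 i)//= lerDl.
by apply: sumr_ge0.
Qed.

End InequalityConstraintsOnly.

(** When c is negative this bounds the sum of the multipliers on every
superlevel set of d. *)
Lemma slater_multiplier_bound xt u (c : R) : slater_point P xt -> D u ->
  (forall i, gcon P i xt <= c) ->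
  dual P u - fobj P xt <= c * \sum_i usubmx u i 0.
Proof.
move=> sl Du gc; have [Xxt _ Axt] := slater_point_feasible sl.
have := dual_le_lagrangian Du Xxt; rewrite /lagrangian Axt dotvC dotv0l addr0.
rewrite addrC -lerBlDr => /le_trans; apply.
by rewrite mulr_sumr; apply: ler_sum => i _; rewrite mulrC ler_wpM2r.
Qed.

Lemma sup_slater (xt : 'cV[R]_n) : (0 < m)%N -> exists i0 : 'I_m,
  sup [set gcon P i xt | i in [set: 'I_m]] = gcon P i0 xt /\
  forall i, gcon P i xt <= gcon P i0 xt.
Proof.
move=> m0; case: (arg_maxP (fun i => gcon P i xt) (isT : xpredT (Ordinal m0))).
move=> i0 _ i0max; have {}i0max i : gcon P i xt <= gcon P i0 xt by exact: i0max.
exists i0; split=> //; apply/eqP; rewrite eq_le; apply/andP; split.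
  by apply: ge_sup; [exists (gcon P i0 xt), i0|move=> _ [i _ <-]].
by apply: ub_le_sup; [exists (gcon P i0 xt) => _ [i _ <-]|exists i0].
Qed.

End Lagrangian.


(** * Bregman proximal steps *)

Section BregmanProx.
Variables (R : realType) (m p : nat) (h : 'cV[R]_(m + p) -> R).
Implicit Types (a w z : 'cV[R]_(m + p)).

Lemma differential_ge_of_increments (w y : 'cV[R]_(m + p)) (c r : R) :
  differentiable h w ->
  (forall t : R, 0 < t <= 1 -> t * r <= c * (h (t *: y + w) - h w)) ->
  r <= c * 'd h w y.
Proof.
move=> dh incr; rewrite -deriveE//.
have /cvg_dnbhs_at_right quot := @diff_derivable _ _ _ _ _ y dh.
have cquot := cvgM (cvg_cst c) quot.
rewrite /derive; apply: (cvgr_to_ge (cquot _ _)); near=> t.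
have t0 : 0 < t by [].
have t1 : t <= 1 by near: t; exact: nbhs_right_le.
have := incr t; rewrite t0 t1 => /(_ isT) /=.
rewrite mulrC -ler_pdivlMr// => /le_trans; apply.
by apply: ler_of_eq; rewrite /= /GRing.scale /=; field; rewrite gt_eqF.
Unshelve. all: by end_near. Qed.

(** Hides the differential at w behind an abstract linear function, which is
all that the prox center contributes to the three-point property. *)
Lemma bregman_linear w : exists d : 'cV[R]_(m + p) -> R,
  [/\ forall x, bregman h x w = h x - h w - d (x - w),
      forall x y, d (x + y) = d x + d y & forall t x, d (t *: x) = t * d x].
Proof.
exists ('d h w); split=> //; first by move=> x y; exact: linearD.
by move=> t x; exact: linearZ.
Qed.

(** The two sides differ by the directional derivative of the objective at the
minimizer towards z, which is nonnegative because S is convex. *)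
Lemma bregman_three_points (S : set 'cV[R]_(m + p)) a w wmin z (k c : R) :
  convex_set S -> differentiable h wmin ->
  argmin S (fun u => k + dotv a u + c * bregman h u w) wmin -> S z ->
  k + dotv a wmin + c * bregman h wmin w + c * bregman h z wmin
  <= k + dotv a z + c * bregman h z w.
Proof.
move=> cS dh [Smin wminP] Sz.
have [d [dE dD dZ]] := bregman_linear w.
have brE : bregman h z wmin = h z - h wmin - 'd h wmin (z - wmin) by [].
have : c * d (z - wmin) - dotv a (z - wmin) <= c * 'd h wmin (z - wmin).
  apply: differential_ge_of_increments => // t /andP[t0 t1].
  have t01 : 0 <= t <= 1 by rewrite ltW.
  have := wminP _ (convex_setP cS Sz Smin t01).
  have -> : t *: z + (1 - t) *: wmin = t *: (z - wmin) + wmin.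
    by apply/matrixP => i j; rewrite !mxE; ring.
  have sE : t *: (z - wmin) + wmin - w = t *: (z - wmin) + (wmin - w).
    by rewrite addrA.
  by rewrite !dE sE (dD (t *: _)) dZ (dotvDr _ (t *: _)) dotvZr => ?; lra.
rewrite brE !dE (_ : z - w = (z - wmin) + (wmin - w));
  last by rewrite addrA subrK.
by rewrite (dD (z - wmin)) dotvBr; move: ('d h wmin _) => *; lra.
Qed.

End BregmanProx.

(** * Convergence of the fast dual gradient method *)

Section FastDualGradient.
Variables (R : realType) (n m p : nat) (P : problem R n m p).
Hypothesis hP : assumptions P.
Hypothesis hp : p = 0%N.
Variables (h : 'cV[R]_(m + p) -> R).
Hypothesis hh : prox_function h.
Variables (beta : nat -> R) (U : nat -> set 'cV[R]_(m + p)).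
Variables (u w v uhat : nat -> 'cV[R]_(m + p)).
Hypothesis halg : fast_dual_gradient P h beta U u w v uhat.
Hypothesis hbeta : forall k, 0 < beta k.+1 /\
  (1 - beta k.+1) / beta k.+1 ^+ 2 <= 1 / beta k ^+ 2.
Variable us : 'cV[R]_(m + p).
Hypothesis us_sol : dual_solutions P us.
Hypothesis hU : forall k, U k us.
Local Notation D := (@dual_domain R m p).

Lemma beta_gt0 k : 0 < beta k.
Proof. by case: k => [|k]; [rewrite (beta_init halg)|case: (hbeta k)]. Qed.

Lemma beta_le_inv k : beta k <= 2 / k.+2%:R.
Proof.
case: k => [|k]; last exact: (beta_le halg).
by rewrite (beta_init halg) divff.
Qed.

Lemma beta_le1 k : beta k <= 1.
Proof.
apply: le_trans (beta_le_inv k) _.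
by rewrite ler_pdivrMr// mul1r ler_nat.
Qed.

Lemma w_dual k : D (w k).
Proof.
by case: k => [|k]; [exact: (w_init halg)|case: (w_step halg k) => -[]].
Qed.

Lemma v_dual k : D (v k).
Proof.
rewrite (v_step halg); apply: dual_domain_convex; first exact: (u_dual halg).
  exact: w_dual.
by rewrite ltW ?beta_gt0// beta_le1.
Qed.

Lemma prox_differentiable z : D z -> differentiable h z.
Proof. by case: hh => [[S [_ DS _ dh]] _] /DS; exact: dh. Qed.

Lemma bregman_ge0 z z' : D z -> D z' -> 0 <= bregman h z z'.
Proof.
move=> Dz Dz'; case: hh => _ /(_ _ _ Dz Dz'); apply: le_trans.
by rewrite divr_ge0// sqr_ge0.
Qed.

Lemma ell_affine z z' : ell P z z' =
  - dual P z' + dotv (grad_dual P z') z' + dotv (- grad_dual P z') z.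
Proof. by rewrite /ell dotvBr dotvNl; ring. Qed.

Lemma ell_le_dual z z' : D z -> D z' -> ell P z z' <= - dual P z.
Proof.
by move=> Dz Dz'; have := dual_le_linearization hP Dz Dz'; rewrite /ell; lra.
Qed.

Lemma dual_cap_convex k : convex_set (U k `&` D).
Proof.
move=> x y t; rewrite !inE => -[Ux Dx] [Uy Dy]; split.
  have Uc : convex_set (U k) by apply: (U_convex halg).
  by have := Uc x y t; rewrite !inE; apply.
have -> : conv t x y = (1 - (1 - t%:num)) *: x + (1 - t%:num) *: y.
  by rewrite subKr.
apply: dual_domain_convex => //.
by rewrite subr_ge0 lerBlDr lerDl; apply/andP; split.
Qed.

(** The accepted point is at least as good as uhat for the quadratic model at
v_k. Since uhat - v_k = beta_k (w_(k+1) - w_k), the model at uhat splits into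
(1 - beta_k) times the linearization at u_k and beta_k times the objective of
the Bregman step, to which the three-point property applies with z = ustar. *)
Lemma gap_recurrence k :
  dual P us - dual P (u k.+1) <= (1 - beta k) * (dual P us - dual P (u k))
    + beta k ^+ 2 * Ltilde P * (bregman h us (w k) - bregman h us (w k.+1)).
Proof.
have Dus : D us by case: us_sol.
have [b0 b1] := (beta_gt0 k, beta_le1 k).
have L0 := Ltilde_ge0 hP hp.
have descent := dual_descent hP hp (u_dual halg k.+1) (v_dual k).
have ustep := u_step halg k.
have uhat_v : uhat k.+1 - v k = beta k *: (w k.+1 - w k).
  rewrite (uhat_step halg) (v_step halg).
  by apply/matrixP => i j; rewrite !mxE; ring.
rewrite uhat_v enorm_sqrZ (uhat_step halg) in ustep.
have ell_uhat : ell P ((1 - beta k) *: u k + beta k *: w k.+1) (v k)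
    = (1 - beta k) * ell P (u k) (v k) + beta k * ell P (w k.+1) (v k).
  by rewrite !ell_affine dotvDr !dotvZr; ring.
have ell_u := ell_le_dual (u_dual halg k) (v_dual k).
have ell_us := ell_le_dual Dus (v_dual k).
have quad : enorm (w k.+1 - w k) ^+ 2 / 2 <= bregman h (w k.+1) (w k).
  by case: hh => _; apply; exact: w_dual.
have three : ell P (w k.+1) (v k) + beta k * Ltilde P * bregman h (w k.+1) (w k)
    + beta k * Ltilde P * bregman h us (w k.+1)
    <= ell P us (v k) + beta k * Ltilde P * bregman h us (w k).
  rewrite !ell_affine; apply: (@bregman_three_points _ _ _ h (U k `&` D)) => //.
  - exact: dual_cap_convex.
  - exact: prox_differentiable (w_dual _).
  - have [Sw wmin] := w_step halg k; split=> // y Sy.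
    by have := wmin y Sy; rewrite !ell_affine.
rewrite ell_uhat in ustep.
have e1 := ler_wpM2l (mulr_ge0 L0 (sqr_ge0 (beta k))) quad.
have e2 := ler_wpM2l (ltW b0) (le_trans three (lerD ell_us (lexx _))).
have e3 := ler_wpM2l (_ : 0 <= 1 - beta k) ell_u.
rewrite subr_ge0 in e3; have {}e3 := e3 b1.
move: descent ustep e1 e2 e3; clear.
move: (enorm _ ^+ 2) (enorm _ ^+ 2) => E1 E2.
move: (ell P (u k.+1) _) (ell P (u k) _) (ell P (w k.+1) _) => l1 l2 l3.
move: (bregman _ _ _) (bregman _ _ _) (bregman _ _ _) => q1 q2 q3.
move: (dual P _) (dual P _) (dual P _) (Ltilde P) (beta k) => d1 d2 d3 L b.
by move=> *; lra.
Qed.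

(** Divided by beta_k^2, the recurrence telescopes because the condition on the
step sizes bounds (1 - beta_(k+1)) / beta_(k+1)^2 by 1 / beta_k^2; at k = 0 the
gap of u_0 disappears since beta_0 = 1. *)
Lemma gap_potential k :
  (dual P us - dual P (u k.+1)) / beta k ^+ 2 + Ltilde P * bregman h us (w k.+1)
  <= Ltilde P * bregman h us (w 0%N).
Proof.
have step j : (dual P us - dual P (u j.+1)) / beta j ^+ 2
      + Ltilde P * bregman h us (w j.+1)
    <= (1 - beta j) / beta j ^+ 2 * (dual P us - dual P (u j))
      + Ltilde P * bregman h us (w j).
  have b2 : 0 < beta j ^+ 2 by rewrite exprn_gt0// beta_gt0.
  rewrite -lerBrDr ler_pdivrMr//; apply: le_trans (gap_recurrence j) _.
  apply: ler_of_eq; field.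
  by rewrite gt_eqF// beta_gt0.
elim: k => [|k IH].
  by have := step 0%N; rewrite {2}(beta_init halg) subrr !mul0r add0r.
apply: le_trans (step k.+1) _; apply: le_trans IH; rewrite lerD2r.
rewrite [leRHS]mulrC -[(beta k ^+ 2)^-1]div1r.
rewrite ler_wpM2r//; last by case: (hbeta k).
by rewrite subr_ge0; case: us_sol => _; apply; exact: (u_dual halg).
Qed.

Lemma dual_gap_rate k : (0 < k)%N ->
  dual P us - dual P (u k)
  <= 4 * Ltilde P * bregman h us (w 0%N) / k.+1%:R ^+ 2.
Proof.
case: k => // k _; have Dus : D us by case: us_sol.
have L0 := Ltilde_ge0 hP hp.
have b2 : 0 < beta k ^+ 2 by rewrite exprn_gt0// beta_gt0.
have Q0 := bregman_ge0 Dus (w_dual 0).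
have := gap_potential k.
move=> /(le_trans _)-/(_ ((dual P us - dual P (u k.+1)) / beta k ^+ 2)).
rewrite lerDl mulr_ge0 ?bregman_ge0//; last exact: w_dual.
move=> /(_ isT); rewrite ler_pdivrMr// => /le_trans; apply.
have : beta k ^+ 2 <= (2 / k.+2%:R) ^+ 2.
  by rewrite ler_pXn2r ?nnegrE ?beta_le_inv ?divr_ge0// ltW// beta_gt0.
move=> /(ler_wpM2l (mulr_ge0 L0 Q0))/le_trans; apply.
by apply: ler_of_eq; rewrite expr_div_n; ring.
Qed.

End FastDualGradient.

Theorem proposition4p5 (R : realType) (n m p : nat) (P : problem R n m p)
    (hP : assumptions P) (hp : p = 0%N)
    (h : 'cV[R]_(m + p) -> R) (hh : prox_function h)
    (beta : nat -> R) (U : nat -> set 'cV[R]_(m + p))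
    (u w v uhat : nat -> 'cV[R]_(m + p))
    (halg : fast_dual_gradient P h beta U u w v uhat)
    (hbeta : forall k, 0 < beta k.+1 /\
       (1 - beta k.+1) / beta k.+1 ^+ 2 <= 1 / beta k ^+ 2)
    (xt : 'cV[R]_n) (hxt : slater_point P xt)
    (ustar : 'cV[R]_(m + p)) (hustar : dual_solutions P ustar)
    (hU : forall k, U k ustar)
    (ubar : 'cV[R]_(m + p))
    (hubar : (@dual_domain R m p `\` dual_solutions P) ubar)
    (k : nat)
    (hk : Num.sqrt (4 * Ltilde P * bregman h ustar (w 0%N)
                    / (dstar P - dual P ubar)) < k%:R) :
  fobj P (xbar P (u k)) - fstar P
  <= Ltilde P * (dual P ubar - fobj P xt)
       * Num.sqrt (8 * (m + p)%:R * bregman h ustar (w 0%N))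
       / (k.+1%:R * sup [set gcon P i xt | i in [set: 'I_m]])
     + 4 * Ltilde P * bregman h ustar (w 0%N) / k.+1%:R ^+ 2.
Proof.
have Dus : dual_domain ustar by case: hustar.
have Duk := u_dual halg k.
have L0 := Ltilde_ge0 hP hp.
have Q0 := bregman_ge0 hh Dus (w_init halg).
have k0 : (0 < k)%N.
  by rewrite -(ltr0n R); apply: le_lt_trans hk; exact: sqrtr_ge0.
have rate := dual_gap_rate hP hp hh halg hbeta hustar hU k0.
have ubar_lt : 0 < dstar P - dual P ubar.
  rewrite (dstarE hustar) subr_gt0 ltNge; apply/negP => le_ubar.
  case: hubar => Dubar; apply; split=> // z Dz; apply: le_trans le_ubar.
  by case: hustar => _; apply.
have ubar_le : dual P ubar <= dual P (u k).
  have : 4 * Ltilde P * bregman h ustar (w 0%N)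
      <= (dstar P - dual P ubar) * k.+1%:R ^+ 2.
    rewrite [leRHS]mulrC -ler_pdivrMr//.
    have hk' : Num.sqrt (4 * Ltilde P * bregman h ustar (w 0%N)
                    / (dstar P - dual P ubar)) <= k.+1%:R.
      by rewrite (le_trans (ltW hk))// ler_nat.
    by rewrite -ler_sqrt ?exprn_ge0// sqrtr_sqr ger0_norm.
  rewrite -ler_pdivrMr ?exprn_gt0// => /(le_trans rate).
  by rewrite (dstarE hustar); lra.
have [i0 [-> gmax]] := sup_slater P xt (m_gt0 hP hp).
set gm := gcon P i0 xt in gmax *.
have gm0 : gm < 0 by case: hxt => _ ->.
have mult : \sum_i usubmx (u k) i 0 <= (dual P ubar - fobj P xt) / gm.
  rewrite ler_ndivlMr//; apply: (@le_trans _ _ (dual P (u k) - fobj P xt)).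
    by rewrite lerD2r.
  by rewrite mulrC; exact: (slater_multiplier_bound hP hxt Duk gmax).
apply: (le_trans (primal_gap_le hP hp hustar Duk)).
have norm_u := le_trans (enorm_le_sum_multipliers hp Duk) mult.
(* The factor m + p inside the root is at least 1. *)
have sqrt_le : Num.sqrt (2 * Ltilde P * (dual P ustar - dual P (u k)))
    <= Ltilde P * Num.sqrt (8 * (m + p)%:R * bregman h ustar (w 0%N)) / k.+1%:R.
  set rhs := (leRHS).
  have rhs0 : 0 <= rhs by rewrite divr_ge0// mulr_ge0// sqrtr_ge0.
  rewrite -[rhs]ger0_norm// -sqrtr_sqr ler_wsqrtr// /rhs.
  rewrite expr_div_n exprMn sqr_sqrtr ?mulr_ge0//.
  apply: (le_trans (ler_wpM2l (mulr_ge0 (ler0n _ 2) L0) rate)).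
  have mp1 : 1 <= (m + p)%:R :> R by rewrite ler1n addn_gt0 (m_gt0 hP hp).
  rewrite mulrA ler_pM2r ?invr_gt0 ?exprn_gt0//.
  set Q := 8 * Ltilde P ^+ 2 * bregman h ustar (w 0%N).
  rewrite [leLHS](_ : _ = 1 * Q); last by rewrite /Q; ring.
  rewrite [leRHS](_ : _ = (m + p)%:R * Q); last by rewrite /Q; ring.
  by rewrite ler_wpM2r// !mulr_ge0// sqr_ge0.
apply: (le_trans (ler_pM (sqrtr_ge0 _) (enorm_ge0 _) sqrt_le norm_u)).
rewrite -[leLHS]addr0; apply: lerD; last first.
  by rewrite divr_ge0 ?exprn_ge0// !mulr_ge0.
have : k.+1%:R != 0 :> R by rewrite pnatr_eq0.
move: k.+1%:R => K K0; apply: ler_of_eq.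
by field; rewrite K0 lt_eqF.
Qed.
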